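(* Let $\psi:\mathbb{R}^n\to\mathbb{R}^n$ be a contraction that is the pointwise limit on $B^n$ of a sequence of finite compositions of contractions associated with polarizations. If the restriction of $\psi$ to $B^n$ is injective, then $\mathcal H^n(\psi(B^n))=\mathcal H^n(B^n)$.
   Context: A contraction is a map with Lipschitz constant $1$. $B^n$ is the closed unit ball. The contraction associated with the polarization with respect to the oriented hyperplane $H=u^\perp+t_0u$ ($u$ a unit vector, positive halfspace $H^+=\{x:\langle x,u\rangle\ge t_0\}$) is $\psi_{P_H}(x)=x+\big(|t_0-\langle x,u\rangle|+(t_0-\langle x,u\rangle)\big)u$, i.e. the identity on $H^+$ and the reflection in $H$ on $H^-$; the hyperplanes may be arbitrary. *)

(* Defs.v *)
From HB Require Import structures.
From mathcomp Require Import all_boot all_order all_algebra.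
From mathcomp Require Import all_classical all_reals all_analysis.
Set Implicit Arguments. Unset Strict Implicit. Unset Printing Implicit Defensive.
Import Order.TTheory GRing.Theory Num.Theory.
Import numFieldNormedType.Exports.
Local Open Scope classical_set_scope.
Local Open Scope ring_scope.

Section Defs.
Variables (R : realType) (n : nat).
Local Notation V := 'rV[R]_n.

Definition pl_dotp (x y : V) : R := \sum_(i < n) x 0 i * y 0 i.
Definition pl_enorm (x : V) : R := Num.sqrt (pl_dotp x x).

Definition pl_unit_ball : set V := [set x | pl_enorm x <= 1].

Definition pl_contraction (f : V -> V) : Prop :=
  forall x y, pl_enorm (f x - f y) <= pl_enorm (x - y).

(* pl_contraction associated with the polarization w.r.t. the oriented
   hyperplane H = u^perp + t0 u (u a unit vector) *)
Definition pl_polar_map (u : V) (t0 : R) (x : V) : V :=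
  x + (`|t0 - pl_dotp x u| + (t0 - pl_dotp x u)) *: u.

Definition pl_hyperplane_ok (h : V * R) : Prop := pl_enorm h.1 = 1.

Definition pl_polar_comp (s : seq (V * R)) : V -> V :=
  foldr (fun h f => pl_polar_map h.1 h.2 \o f) id s.

(* Euclidean diameter of a set (only used for sets of bounded diameter) *)
Definition pl_ediam (C : set V) : R :=
  sup [set r | exists x y, C x /\ C y /\ r = pl_enorm (x - y)].

(* delta-approximating Hausdorff content, with the convention diam(∅)^n = 0 *)
Definition pl_hausdorff_delta (delta : R) (A : set V) : \bar R :=
  ereal_inf [set (\sum_(i <oo) (if `[< C i !=set0 >] then (pl_ediam (C i) ^+ n)%:E
                                 else 0%E))%E
            | C in [set C : nat -> set V |
                     A `<=` \bigcup_i C i /\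
                     forall i, forall x y, C i x -> C i y -> pl_enorm (x - y) <= delta]].

(* n-dimensional Hausdorff measure (unnormalized) *)
Definition pl_hausdorff (A : set V) : \bar R :=
  ereal_sup [set pl_hausdorff_delta delta A | delta in [set d : R | 0 < d]].

End Defs.

(* Main.v *)
(* A polarization map identifies points that are mirror images in its
   hyperplane, and whatever it identifies stays identified under all later maps.
   By compactness of the ball B and injectivity of psi, for every d > 0 the
   compositions f_k eventually identify only points of B at distance at most d.
   Such a composition is an isometry composed with a retraction of B onto B minus
   finitely many caps of height at most d: the composed isometry is absorbed into
   the next polarization, which then folds a cap of B onto its larger side. A deep
   cap would identify two distant points of the part of B that is still fixed, and
   if the height of a cap is moderate, its pole is identified with a point on the
   far side of the hyperplane, so the height is at most d after all. Hence f_k is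
   isometric on (1 - d) B, psi is isometric on B, and diameters of covering sets
   can be transported in both directions. *)
Require Import Defs.
From HB Require Import structures.
From mathcomp Require Import all_boot all_order all_algebra.
From mathcomp Require Import all_classical all_reals all_analysis.
From mathcomp Require Import ring lra.
Import Order.TTheory GRing.Theory Num.Theory.
Import numFieldNormedType.Exports.
Local Open Scope classical_set_scope.
Local Open Scope ring_scope.

(** * The Euclidean inner product and norm *)

Section DotProduct.
Set Implicit Arguments.
Unset Strict Implicit.
Context {R : realType} {n : nat}.
Implicit Types (x y z u v : 'rV[R]_n) (a r : R).

Lemma dotpC x y : pl_dotp x y = pl_dotp y x.
Proof. by apply: eq_bigr => i _; rewrite mulrC. Qed.

Lemma dotpDl x y z : pl_dotp (x + y) z = pl_dotp x z + pl_dotp y z.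
Proof. by rewrite -big_split; apply: eq_bigr => i _; rewrite mxE mulrDl. Qed.

Lemma dotpZl a x z : pl_dotp (a *: x) z = a * pl_dotp x z.
Proof. by rewrite /pl_dotp mulr_sumr; apply: eq_bigr => i _; rewrite mxE mulrA. Qed.

Lemma dotpNl x z : pl_dotp (- x) z = - pl_dotp x z.
Proof. by rewrite -scaleN1r dotpZl mulN1r. Qed.

Lemma dotpDr x y z : pl_dotp z (x + y) = pl_dotp z x + pl_dotp z y.
Proof. by rewrite dotpC dotpDl !(dotpC _ z). Qed.

Lemma dotpZr a x z : pl_dotp z (a *: x) = a * pl_dotp z x.
Proof. by rewrite dotpC dotpZl dotpC. Qed.

Lemma dotpNr x z : pl_dotp z (- x) = - pl_dotp z x.
Proof. by rewrite dotpC dotpNl dotpC. Qed.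

Definition dotpE := (dotpDl, dotpDr, dotpZl, dotpZr, dotpNl, dotpNr).

Lemma dotp_ge0 x : 0 <= pl_dotp x x.
Proof. by apply: sumr_ge0 => i _; rewrite -expr2 sqr_ge0. Qed.

Lemma enorm_ge0 x : 0 <= pl_enorm x.
Proof. exact: sqrtr_ge0. Qed.

Lemma sqr_enorm x : pl_enorm x ^+ 2 = pl_dotp x x.
Proof. by rewrite sqr_sqrtr ?dotp_ge0. Qed.

Lemma le_enorm x y : (pl_enorm x <= pl_enorm y) = (pl_dotp x x <= pl_dotp y y).
Proof. by rewrite -!sqr_enorm ler_pXn2r // nnegrE enorm_ge0. Qed.

Lemma enorm_le x r : 0 <= r -> (pl_enorm x <= r) = (pl_dotp x x <= r ^+ 2).
Proof. by move=> r0; rewrite -sqr_enorm ler_pXn2r // nnegrE enorm_ge0. Qed.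

Lemma enorm_eq1 x : pl_enorm x = 1 -> pl_dotp x x = 1.
Proof. by move=> x1; rewrite -sqr_enorm x1 expr1n. Qed.

Lemma unit_ballE x : pl_unit_ball x <-> pl_dotp x x <= 1.
Proof. by rewrite /pl_unit_ball /= enorm_le // expr1n. Qed.

Lemma enorm0 : pl_enorm (0 : 'rV[R]_n) = 0.
Proof. by rewrite -[0](scale0r 0) /pl_enorm dotpZl mul0r sqrtr0. Qed.

Lemma enorm0_eq0 x : pl_enorm x = 0 -> x = 0.
Proof.
move=> x0; have : pl_dotp x x == 0 by rewrite -sqr_enorm x0 expr0n.
rewrite psumr_eq0 => [/allP xi0|i _]; last by rewrite -expr2 sqr_ge0.
apply/rowP => i; rewrite mxE; apply/eqP.
by have := xi0 i (mem_index_enum _); rewrite mulf_eq0 orbb.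
Qed.

Lemma enormN x : pl_enorm (- x) = pl_enorm x.
Proof. by rewrite /pl_enorm !dotpE opprK. Qed.

Lemma enormZ a x : 0 <= a -> pl_enorm (a *: x) = a * pl_enorm x.
Proof.
by move=> a0; rewrite /pl_enorm !dotpE mulrA -expr2 sqrtrM ?sqr_ge0 // sqrtr_sqr ger0_norm.
Qed.

(** One-sided Cauchy-Schwarz against a unit vector, read off from |x + r v|^2 >= 0. *)
Lemma dotp_ler r x v : 0 < r -> pl_dotp x x <= r ^+ 2 -> pl_dotp v v = 1 ->
  - r <= pl_dotp x v.
Proof.
move=> r0 xr v1; have := dotp_ge0 (x + r *: v).
rewrite !dotpE v1 (dotpC v x) => h.
have : 0 <= 2 * r * (pl_dotp x v + r) by nra.
by rewrite pmulr_rge0; lra.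
Qed.

Lemma le_enormD x y : pl_enorm (x + y) <= pl_enorm x + pl_enorm y.
Proof.
rewrite enorm_le ?addr_ge0 ?enorm_ge0 // sqrrD !sqr_enorm !dotpE (dotpC y x).
suff : pl_dotp x y <= pl_enorm x * pl_enorm y by lra.
have [y0|y0] := eqVneq (pl_enorm y) 0.
  by rewrite (enorm0_eq0 y0) -(scale0r 0) dotpZr mul0r enormZ // !mul0r mulr0.
have [x0|x0] := eqVneq (pl_enorm x) 0.
  by rewrite (enorm0_eq0 x0) -(scale0r 0) dotpZl mul0r enormZ // !mul0r.
have yp : 0 < pl_enorm y by rewrite lt_neqAle eq_sym y0 enorm_ge0.
have xp : 0 < pl_enorm x by rewrite lt_neqAle eq_sym x0 enorm_ge0.
(* The minus sign turns the lower bound of [dotp_ler] into the upper bound of Cauchy-Schwarz. *)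
have e1 : pl_dotp (- (pl_enorm y)^-1 *: y) (- (pl_enorm y)^-1 *: y) = 1.
  by rewrite !dotpE -sqr_enorm; field.
have xx : pl_dotp x x <= pl_enorm x ^+ 2 by rewrite sqr_enorm.
have := dotp_ler xp xx e1; rewrite dotpZr.
by rewrite mulNr lerN2 mulrC ler_pdivrMr.
Qed.

Lemma enorm_distC x y : pl_enorm (x - y) = pl_enorm (y - x).
Proof. by rewrite -enormN opprB. Qed.

Lemma enorm_distD y x z : pl_enorm (x - z) <= pl_enorm (x - y) + pl_enorm (y - z).
Proof. by apply: le_trans (le_enormD _ _); rewrite addrA subrK. Qed.

End DotProduct.

(** * Polarizations and the structure of their compositions *)

Section Polarization.
Set Implicit Arguments.
Unset Strict Implicit.
Context {R : realType} {n : nat}.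
Local Notation V := 'rV[R]_n.
Implicit Types (x y u v a : V) (t c d : R) (h : V * R).

Lemma polar_map_id v t x : t <= pl_dotp x v -> pl_polar_map v t x = x.
Proof.
by move=> tx; rewrite /pl_polar_map ler0_norm ?subr_le0 // addNr scale0r addr0.
Qed.

Definition hyperplane_reflection v t x : V := x + (2 * (t - pl_dotp x v)) *: v.

Lemma polar_map_reflection v t x : pl_dotp x v <= t ->
  pl_polar_map v t x = hyperplane_reflection v t x.
Proof.
move=> xt; rewrite /pl_polar_map /hyperplane_reflection ger0_norm ?subr_ge0 //.
by congr (_ + _ *: _); ring.
Qed.

Lemma hyperplane_reflectionK v t : pl_dotp v v = 1 ->
  involutive (hyperplane_reflection v t).
Proof.
move=> v1 x; rewrite /hyperplane_reflection !dotpE v1 -addrA -scalerDl.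
by rewrite [X in X *: _](_ : _ = 0) ?scale0r ?addr0 //; ring.
Qed.

Lemma hyperplane_reflectionN v t x :
  hyperplane_reflection (- v) (- t) x = hyperplane_reflection v t x.
Proof.
by rewrite /hyperplane_reflection scalerN -scaleNr dotpNr; congr (_ + _ *: _); ring.
Qed.

(** Folding onto one side is folding onto the other and then reflecting. This leaves the choice of
    the side that stays fixed. *)
Lemma polar_mapN v t x : pl_dotp v v = 1 ->
  pl_polar_map v t x = hyperplane_reflection v t (pl_polar_map (- v) (- t) x).
Proof.
move=> v1; have [xt|/ltW xt] := leP (pl_dotp x v) t.
  by rewrite polar_map_reflection // polar_map_id // dotpNr lerN2.
rewrite polar_map_id // polar_map_reflection; last by rewrite dotpNr lerN2.
by rewrite hyperplane_reflectionN hyperplane_reflectionK.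
Qed.

(** Only the coordinate along [v] changes: it goes from p to t + |t - p|, which is 1-Lipschitz in
    p. *)
Lemma polar_map_contraction v t : pl_dotp v v = 1 -> pl_contraction (pl_polar_map v t).
Proof.
move=> v1 x y; rewrite le_enorm /pl_polar_map.
set a := `|t - pl_dotp x v| + _; set b := `|t - pl_dotp y v| + _.
rewrite (_ : _ - _ = (x - y) + (a - b) *: v); last first.
  by rewrite scalerBl opprD addrACA.
have : pl_dotp (x - y) v = pl_dotp x v - pl_dotp y v by rewrite !dotpE.
move: (x - y) => z zv; rewrite !dotpE v1 (dotpC v z) zv.
rewrite {}/a {}/b {zv}; move: (pl_dotp x v) (pl_dotp y v) (pl_dotp z z) => p q r.
by case: (ger0P (t - p)) => tp; case: (ger0P (t - q)) => tq; nra.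
Qed.

Lemma polar_comp_contraction (s : seq (V * R)) :
  (forall h, h \in s -> pl_hyperplane_ok h) -> pl_contraction (pl_polar_comp s).
Proof.
elim: s => [_ x y //|h s IH hs x y] /=.
have h1 : pl_dotp h.1 h.1 = 1 by apply/enorm_eq1/hs; rewrite mem_head.
apply: le_trans (polar_map_contraction h.2 h1 _ _) (IH _ _ _) => h' h's.
by apply: hs; rewrite inE h's orbT.
Qed.

(* The second clause makes it possible to move an isometry past a fold. *)
Definition folding_isometry (T : V -> V) :=
  (forall x y, pl_enorm (T x - T y) = pl_enorm (x - y)) /\
  (forall u t, pl_dotp u u = 1 -> exists v c, pl_dotp v v = 1 /\
     forall x, pl_polar_map u t (T x) = T (pl_polar_map v c x)).

Lemma folding_isometry_id : folding_isometry id.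
Proof. by split=> // u t u1; exists u, t. Qed.

Lemma folding_isometry_reflection T a c : pl_dotp a a = 1 ->
  folding_isometry T -> folding_isometry (T \o hyperplane_reflection a c).
Proof.
move=> a1 [Tiso Tfold]; split=> [x y|u t u1] /=.
  rewrite Tiso /pl_enorm; congr Num.sqrt; rewrite /hyperplane_reflection.
  rewrite (_ : _ - _ = (x - y) + (- 2 * (pl_dotp (x - y) a)) *: a).
    by rewrite !dotpE a1 !(dotpC a); ring.
  rewrite opprD addrACA -scalerBl !dotpE; congr (_ + _ *: _); ring.
have [v [d [v1 Tv]]] := Tfold u t u1.
(* The preimage of the halfspace <y, v> >= d under the reflection, obtained by expanding <x + 2(c -
   <x, a>)a, v> >= d. *)
exists (v - (2 * pl_dotp v a) *: a), (d - 2 * c * pl_dotp v a).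
split=> [|x]; first by rewrite !dotpE a1 v1 (dotpC a v); ring.
rewrite Tv; congr T; rewrite /pl_polar_map /hyperplane_reflection.
set m := d - _; rewrite (_ : d - _ - _ = m); last first.
  by rewrite /m !dotpE (dotpC a v); ring.
by apply/rowP => i; rewrite !dotpE a1 !mxE; ring.
Qed.

Definition cut_ball (L : seq (V * R)) : set V :=
  [set x | pl_dotp x x <= 1 /\ forall h, h \in L -> h.2 <= pl_dotp x h.1].

(** Each constraint removes from the unit ball a cap of height at most [d], possibly an empty
    one. *)
Definition shallow_cuts d (L : seq (V * R)) :=
  forall h, h \in L -> pl_dotp h.1 h.1 = 1 /\ h.2 <= - (1 - d).

Lemma small_ball_cut_ball d L x : 0 <= d -> d < 1 -> shallow_cuts d L ->
  pl_dotp x x <= (1 - d) ^+ 2 -> cut_ball L x.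
Proof.
move=> d0 d1 hL xd; split=> [|h /hL [h1 h2]]; first by nra.
by apply: le_trans h2 _; apply: dotp_ler => //; rewrite subr_gt0.
Qed.

(* If [x] is moved then [x] is within sqrt(1/5) of [- v], so a constraint whose
   normal makes an obtuse angle with [v] is far from being active at [x]; the
   other constraints are only helped by moving in the direction [v]. *)
Lemma polar_map_cut_ball d L v c x : 0 <= d -> d <= 40^-1 -> shallow_cuts d L ->
  pl_dotp v v = 1 -> c <= - (9 / 10) -> cut_ball L x ->
  cut_ball ((v, c) :: L) (pl_polar_map v c x).
Proof.
move=> d0 d40 hL v1 c9 [x1 xL].
have [cx|/ltW xc] := leP c (pl_dotp x v).
  rewrite polar_map_id //; split=> // h; rewrite inE => /orP[/eqP -> //|]; exact: xL.
rewrite polar_map_reflection // /hyperplane_reflection.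
have xv : - 1 <= pl_dotp x v by apply: dotp_ler; rewrite // expr1n.
split=> [|h]; first by rewrite !dotpE v1 (dotpC v x); nra.
rewrite inE => /orP[/eqP -> /=|hinL]; first by rewrite !dotpE v1; lra.
have [h1 h2] := hL _ hinL; have xh := xL _ hinL.
rewrite dotpDl dotpZl; have [vh|vh] := lerP 0 (pl_dotp v h.1).
  by apply: le_trans xh _; rewrite lerDl mulr_ge0 // mulr_ge0 // subr_ge0.
have vh1 : - 1 <= pl_dotp v h.1 by apply: dotp_ler; rewrite // ?expr1n ?v1.
(* Since |x + v|^2 <= 2 + 2c <= 1/5, this gives <h.1, x + v> >= -9/20, more than the -7/10 used
   next. The reflection then costs at most 1/5, and -9/10 is still above -39/40 >= [h.2]. *)
have : 0 <= pl_dotp (h.1 + 2 *: (x + v)) (h.1 + 2 *: (x + v)) := dotp_ge0 _.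
rewrite !dotpE h1 v1 (dotpC v x) !(dotpC h.1) => hxv.
have : - (7 / 10) <= pl_dotp x h.1 + pl_dotp v h.1 by nra.
nra.
Qed.

(** Maps are added from the innermost outwards; a tail inherits the hypothesis because what it
    identifies stays identified. As [q] fixes [cut_ball L] pointwise, each new fold can be tested on
    explicit points of the cut ball. *)
Lemma polar_comp_factor d (s : seq (V * R)) : 0 < d -> d <= 40^-1 ->
  (forall h, h \in s -> pl_hyperplane_ok h) ->
  (forall x y, pl_unit_ball x -> pl_unit_ball y ->
     pl_polar_comp s x = pl_polar_comp s y -> pl_enorm (x - y) <= d) ->
  exists T q L, [/\ folding_isometry T, shallow_cuts d L,
    forall x, pl_unit_ball x -> pl_polar_comp s x = T (q x),
    forall x, pl_unit_ball x -> cut_ball L (q x) &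
    forall x, cut_ball L x -> q x = x].
Proof.
move=> d0 d40; elim: s => [_ _|[u t] s IH hs id_close].
  exists id, id, [::]; split=> //; first exact: folding_isometry_id.
  by move=> x /unit_ballE x1; split.
have {IH} [||T [q [L [Tiso hL sT qL qid]]]] := IH.
- by move=> h h_s; apply: hs; rewrite inE h_s orbT.
- by move=> x y x1 y1 xy; apply: id_close => //=; rewrite xy.
have u1 : pl_dotp u u = 1.
  by apply: enorm_eq1; apply: (hs (u, t)); rewrite mem_head.
(* Absorb a reflection into [T] if needed, so that the fold keeps the larger side. *)
have [T' [v [c [T'iso v1 c0 sT']]]] : exists T' v c,
    [/\ folding_isometry T', pl_dotp v v = 1, c <= 0 &
     forall x, pl_unit_ball x ->
       pl_polar_comp ((u, t) :: s) x = T' (pl_polar_map v c (q x))].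
  have [v [c [v1 Tv]]] := Tiso.2 u t u1.
  have [c0|/ltW c0] := leP c 0.
    by exists T, v, c; split=> // x x1 /=; rewrite sT // Tv.
  exists (T \o hyperplane_reflection v c), (- v), (- c); split.
  - exact: folding_isometry_reflection.
  - by rewrite !dotpE opprK.
  - by rewrite oppr_le0.
  - by move=> x x1 /=; rewrite sT // Tv polar_mapN.
have d1 : d < 1 by lra.
have cut_unit L' x : cut_ball L' x -> pl_unit_ball x by move=> [x1 _]; apply/unit_ballE.
have c9 : c <= - (9 / 10).
  rewrite leNgt; apply/negP => c9.
  (* [y] is the mirror image of [x], and both lie in the ball of radius 1 - d, which no cut reaches.
     Their distance 2(c + 1 - d) exceeds 3/20 when c > -9/10 and d <= 1/40, hence exceeds [d]. *)
  pose x := - (1 - d) *: v; pose y := (2 * c + (1 - d)) *: v.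
  have xL : cut_ball L x.
    by apply: small_ball_cut_ball (ltW d0) d1 hL _; rewrite !dotpE v1; lra.
  have yL : cut_ball L y.
    by apply: small_ball_cut_ball (ltW d0) d1 hL _; rewrite !dotpE v1; nra.
  have /id_close : pl_polar_comp ((u, t) :: s) x = pl_polar_comp ((u, t) :: s) y.
    rewrite !sT' ?(qid _ xL) ?(qid _ yL) //; [|exact: cut_unit yL|exact: cut_unit xL].
    congr T'.
    rewrite [RHS]polar_map_id; last by rewrite dotpZl v1; lra.
    rewrite polar_map_reflection; last by rewrite dotpZl v1; lra.
    by rewrite /hyperplane_reflection dotpZl v1 -scalerDl; congr (_ *: _); ring.
  move=> /(_ (cut_unit _ _ xL) (cut_unit _ _ yL)).
  by rewrite -scalerBl (enorm_le _ (ltW d0)) !dotpE v1; nra.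
pose q' x := pl_polar_map v c (q x).
have q'L x : pl_unit_ball x -> cut_ball ((v, c) :: L) (q' x).
  by move=> x1; apply: (polar_map_cut_ball (ltW d0)) => //; exact: qL.
have q'id x : cut_ball ((v, c) :: L) x -> q' x = x.
  move=> [x1 xL]; rewrite /q' qid.
    by rewrite polar_map_id //; apply: (xL (v, c)); rewrite mem_head.
  by split=> // h hinL; apply: xL; rewrite inE hinL orbT.
exists T', q', ((v, c) :: L); split=> //.
move=> h; rewrite inE => /orP[/eqP -> /=|]; last exact: hL.
split=> //.
(* The pole [- v] is identified with the point [q' (- v)] of the halfspace. *)
have Nv1 : pl_unit_ball (- v) by apply/unit_ballE; rewrite !dotpE v1 opprK.
have yL := q'L _ Nv1.
have : pl_enorm (- v - q' (- v)) <= d.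
  apply: id_close => //; first exact: cut_unit yL.
  by rewrite !sT' // -?/(q' _) ?(q'id _ yL) //; exact: cut_unit yL.
move: (q' (- v)) yL => y yL; rewrite (enorm_le _ (ltW d0)) => /(dotp_ler d0) /(_ v1).
rewrite !dotpE v1; have := yL.2 (v, c) (mem_head _ _); rewrite /=; lra.
Qed.

(** On the ball of radius 1 - d the retraction [q] is the identity, so only the isometry [T]
    acts. *)
Lemma polar_comp_isometry d (s : seq (V * R)) : 0 < d -> d <= 40^-1 ->
  (forall h, h \in s -> pl_hyperplane_ok h) ->
  (forall x y, pl_unit_ball x -> pl_unit_ball y ->
     pl_polar_comp s x = pl_polar_comp s y -> pl_enorm (x - y) <= d) ->
  forall x y, pl_unit_ball x -> pl_unit_ball y ->
    pl_enorm (pl_polar_comp s ((1 - d) *: x) - pl_polar_comp s ((1 - d) *: y)) =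
    (1 - d) * pl_enorm (x - y).
Proof.
move=> d0 d40 hs id_close.
have [T [q [L [Tiso hL sT _ qid]]]] := polar_comp_factor d0 d40 hs id_close.
have d1 : d < 1 by lra.
have scaled x : pl_unit_ball x -> cut_ball L ((1 - d) *: x).
  move=> /unit_ballE x1; apply: small_ball_cut_ball (ltW d0) d1 hL _.
  by rewrite !dotpE mulrA -expr2 ler_piMr ?sqr_ge0.
move=> x y x1 y1; have := (scaled _ x1, scaled _ y1) => -[xL yL].
rewrite !sT ?qid //; last 2 first.
- by apply/unit_ballE; case: yL.
- by apply/unit_ballE; case: xL.
by rewrite Tiso.1 -scalerBr enormZ // subr_ge0 ltW.
Qed.

End Polarization.

(** * Compactness and passage to the limit *)

Section Limit.
Set Implicit Arguments.
Unset Strict Implicit.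
Context {R : realType} {n : nat}.
Local Notation V := 'rV[R]_n.

(** The topology on row vectors is that of the max norm; this links it to the Euclidean distance. *)
Lemma continuous_enorm_dist (x : V) : continuous (fun y : V => pl_enorm (y - x)).
Proof.
have cdot : continuous (fun y : V => pl_dotp (y - x) (y - x)).
  apply: continuous_big => [|i _ y]; first exact: add_continuous.
  have yi : {for y, continuous (fun z : V => (z - x) 0 i)}.
    have -> : (fun z : V => (z - x) 0 i) = (fun z => z 0 i - x 0 i).
      by apply/funext => z; rewrite !mxE.
    have h := @coord_continuous R 1 n 0 i y.
    have hx : {for y, continuous (fun _ : V => x 0 i)} by exact: cst_continuous.
    exact: (@continuousB R R V _ _ y h hx).
  exact: (@continuousM R V _ _ y yi yi).
move=> y; apply: (continuous_comp (cdot y)); exact: sqrt_continuous.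
Qed.

Lemma near_enorm (x : V) (e : R) : 0 < e -> \forall y \near x, pl_enorm (y - x) < e.
Proof.
move=> e0; have /cvgr_lt := @continuous_enorm_dist x x.
by rewrite subrr enorm0; apply.
Qed.

Lemma compact_unit_ball : compact (@pl_unit_ball R n).
Proof.
apply: bounded_closed_compact.
  exists 1; split=> // M M1 x /unit_ballE x1; apply: le_trans (ltW M1).
  rewrite /Num.norm /= mx_normrE; apply/bigmax_leP; split=> // -[i j] _ /=.
  rewrite (ord1 i) -(@ler_pXn2r _ 2) ?nnegrE // expr1n real_normK ?num_real //.
  apply: le_trans x1; rewrite /pl_dotp (bigD1 j) //= -expr2 lerDl.
  by apply: sumr_ge0 => k _; rewrite -expr2 sqr_ge0.
rewrite (_ : @pl_unit_ball R n = (fun x => pl_enorm (x - 0)) @^-1` [set r | r <= 1]).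
  by apply: closed_comp; [move=> x _; exact: continuous_enorm_dist|exact: closed_le].
by apply/seteqP; split=> x /=; rewrite subr0.
Qed.

Lemma near_enorm_lim (f : nat -> V) (l : V) (e : R) : 0 < e ->
  f k @[k --> \oo] --> l -> \forall k \near \oo, pl_enorm (f k - l) < e.
Proof. by move=> e0 fl; exact: fl _ (near_enorm l e0). Qed.

(** Local at each pair (x, y), then uniform by compactness of the product of the ball with itself.
    Near the diagonal closeness is automatic; off it g x and g y differ, and as the [f k] are
    contractions, pairs near (x, y) are not identified for large k. *)
Lemma injective_limit_identifies_close (f : nat -> V -> V) (g : V -> V) (d : R) :
  (forall k, pl_contraction (f k)) ->
  (forall x, pl_unit_ball x -> f k x @[k --> \oo] --> g x) ->
  {in (@pl_unit_ball R n) &, injective g} -> 0 < d ->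
  \forall k \near \oo, forall x y, pl_unit_ball x -> pl_unit_ball y ->
    f k x = f k y -> pl_enorm (x - y) <= d.
Proof.
move=> fcon fg ginj d0.
have /compact_near_coveringP cov := compact_setX compact_unit_ball compact_unit_ball.
pose P k (p : V * V) := f k p.1 = f k p.2 -> pl_enorm (p.1 - p.2) <= d.
suff /(cov nat \oo P _) : forall p, (@pl_unit_ball R n `*` @pl_unit_ball R n) p ->
    \forall p' \near p & k \near \oo, P k p'.
  by apply: filterS => k kP x y x1 y1; exact: (kP (x, y)).
move=> [x y] [/= x1 y1].
have near_xy (e : R) : 0 < e ->
    \forall p \near (x, y), pl_enorm (p.1 - x) < e /\ pl_enorm (p.2 - y) < e.
  move=> e0; exists ([set z | pl_enorm (z - x) < e], [set z | pl_enorm (z - y) < e]).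
    by split; exact: near_enorm.
  by [].
have [exy|xy] := eqVneq x y.
  have d2 : 0 < d / 2 by rewrite divr_gt0.
  near=> p k => _.
  have [] : pl_enorm (p.1 - x) < d / 2 /\ pl_enorm (p.2 - y) < d / 2.
    by near: p; exact: near_xy.
  rewrite -exy; have := enorm_distD x p.1 p.2; rewrite (enorm_distC x p.2); lra.
(* The path g x, f x, f p.1 = f p.2, f y, g y has four legs, each shorter than [e] in the situation
   below. *)
pose e := pl_enorm (g x - g y) / 4.
have e0 : 0 < e.
  rewrite divr_gt0 // lt_neqAle enorm_ge0 andbT eq_sym; apply: contra_neq xy.
  by move=> /enorm0_eq0/subr0_eq; apply: ginj; rewrite inE.
near=> p k => pq.
have [] : pl_enorm (p.1 - x) < e /\ pl_enorm (p.2 - y) < e.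
  by near: p; exact: near_xy.
have : pl_enorm (f k y - g y) < e by near: k; apply: near_enorm_lim => //; exact: fg.
have : pl_enorm (f k x - g x) < e by near: k; apply: near_enorm_lim => //; exact: fg.
have := enorm_distD (f k x) (g x) (g y); have := enorm_distD (f k p.1) (f k x) (g y).
have := enorm_distD (f k y) (f k p.2) (g y); rewrite -{1}pq.
rewrite (enorm_distC (g x) (f k x)) (enorm_distC (f k x) (f k p.1)).
have := fcon k p.1 x; have := fcon k p.2 y; rewrite /e; lra.
Unshelve. all: by end_near.
Qed.

Lemma polar_comp_limit_isometry (psi : V -> V) (s : nat -> seq (V * R)) :
  pl_contraction psi ->
  (forall k h, h \in s k -> pl_hyperplane_ok h) ->
  (forall x, pl_unit_ball x -> pl_polar_comp (s k) x @[k --> \oo] --> psi x) ->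
  {in (@pl_unit_ball R n) &, injective psi} ->
  forall x y, pl_unit_ball x -> pl_unit_ball y ->
    pl_enorm (psi x - psi y) = pl_enorm (x - y).
Proof.
move=> psicon hs spsi psi_inj x y x1 y1; apply/eqP; rewrite eq_le psicon /=.
apply/ler_addgt0Pr => e e0.
(* The total error is 6d: 2d from the factor 1 - d, as |x - y| <= 2; 2d from moving [x] and [y]
   inwards under [psi]; 2d from replacing [psi] by the composition. *)
pose d := Num.min 40^-1 (e / 6).
have d0 : 0 < d by rewrite lt_min; apply/andP; split; lra.
have d40 : d <= 40^-1 by rewrite ge_min lexx.
have de : d <= e / 6 by rewrite ge_min lexx orbT.
have fcon k := polar_comp_contraction (hs k).
have scaled z : pl_unit_ball z -> pl_unit_ball ((1 - d) *: z) /\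
    pl_enorm (psi ((1 - d) *: z) - psi z) <= d.
  move=> z1; split; first by rewrite /pl_unit_ball /= enormZ; [|lra];
    have := enorm_ge0 z; rewrite /pl_unit_ball /= in z1; nra.
  apply: le_trans (psicon _ _) _.
  rewrite scalerBl scale1r addrAC subrr add0r enormN (enormZ _ (ltW d0)).
  by rewrite ger_pMr.
have [x'1 psix] := scaled _ x1; have [y'1 psiy] := scaled _ y1.
have [k [kid [kx ky]]] : exists k, (forall x y, pl_unit_ball x -> pl_unit_ball y ->
      pl_polar_comp (s k) x = pl_polar_comp (s k) y -> pl_enorm (x - y) <= d) /\
    pl_enorm (pl_polar_comp (s k) ((1 - d) *: x) - psi ((1 - d) *: x)) < d /\
    pl_enorm (pl_polar_comp (s k) ((1 - d) *: y) - psi ((1 - d) *: y)) < d.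
  apply: (@filter_ex _ \oo); apply: filterI.
    exact: injective_limit_identifies_close fcon spsi psi_inj d0.
  by apply: filterI; apply: near_enorm_lim => //; exact: spsi.
have := polar_comp_isometry d0 d40 (hs k) kid x1 y1.
move: kx ky psix psiy.
move: ((1 - d) *: x) ((1 - d) *: y) (pl_polar_comp (s k)) => x' y' f kx ky psix psiy fxy.
have := enorm_distD (psi x') (f x') (f y').
have := enorm_distD (psi y') (psi x') (f y').
have := enorm_distD (psi x) (psi x') (psi y').
have := enorm_distD (psi y) (psi x) (psi y').
have := enorm_distD 0 x y; rewrite sub0r subr0 enormN.
rewrite (enorm_distC (psi y) (psi y')) (enorm_distC (psi y') (f y')).
rewrite /pl_unit_ball /= in x1 y1.
nra.
Qed.

End Limit.

(** * Hausdorff measure under isometries *)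

Section Hausdorff.
Set Implicit Arguments.
Unset Strict Implicit.
Context {R : realType} {n : nat}.
Local Notation V := 'rV[R]_n.

(** The bound [e] ensures that the supremum is a true one and not the default value; sets of a cover
    carry it by definition. *)
Lemma ediam_ub (C : set V) (e : R) x y : (forall x y, C x -> C y -> pl_enorm (x - y) <= e) ->
  C x -> C y -> pl_enorm (x - y) <= pl_ediam C.
Proof.
move=> Ce Cx Cy; apply: ub_le_sup; last by exists x, y.
by exists e => _ [a [b [Ca [Cb ->]]]]; exact: Ce.
Qed.

Lemma ediam_ge0 (C : set V) (e : R) : (forall x y, C x -> C y -> pl_enorm (x - y) <= e) ->
  C !=set0 -> 0 <= pl_ediam C.
Proof.
by move=> Ce [x Cx]; rewrite -(@enorm0 R n) -(subrr x); exact: (ediam_ub Ce Cx Cx).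
Qed.

(* Stated for a relation so that it applies both to a map and to its inverse. *)
Lemma hausdorff_le (A B : set V) (r : V -> V -> Prop) :
  (forall y, B y -> exists2 x, A x & r x y) ->
  (forall x x' y y', r x y -> r x' y' -> pl_enorm (y - y') <= pl_enorm (x - x')) ->
  (pl_hausdorff B <= pl_hausdorff A)%E.
Proof.
move=> rB rcon; apply: ge_ereal_sup => _ [e /= e0 <-].
apply: le_ereal_sup_tmp; exists (pl_hausdorff_delta e A); first by exists e.
apply: le_ereal_inf_tmp => _ [C [AC Ce] <-].
pose D i := [set y | exists2 x, C i x & r x y].
have De i x y : D i x -> D i y -> pl_enorm (x - y) <= e.
  by move=> [a Ca ra] [b Cb rb]; apply: le_trans (rcon _ _ _ _ ra rb) (Ce i _ _ Ca Cb).
apply: ge_ereal_inf; eexists.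
  exists D; last by reflexivity.
  split=> // y /rB[x /AC[i _ Cx] rxy]; exists i => //; by exists x.
apply: lee_nneseries => i _; first move=> _.
  by case: asboolP => // /(ediam_ge0 (De i)) D0; rewrite lee_fin exprn_ge0.
case: asboolP => [D0|_]; last first.
  by case: asboolP => // /(ediam_ge0 (Ce i)) C0; rewrite lee_fin exprn_ge0.
(* Empty pieces count 0, so [C i] must be seen to be nonempty before diameters are compared. In
   dimension 0 every nonempty piece counts 1. *)
have [y0 Dy0] := D0; have [x0 Cx0 _] := Dy0; have C0 : C i !=set0 by exists x0.
case: asboolP => // _; rewrite lee_fin lerXn2r ?nnegrE ?(ediam_ge0 (De i)) ?(ediam_ge0 (Ce i)) //.
apply: ge_sup; first by exists (pl_enorm (y0 - y0)), y0, y0.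
move=> _ [x [y [[a Ca ra] [[b Cb rb] ->]]]].
exact: le_trans (rcon _ _ _ _ ra rb) (ediam_ub (Ce i) Ca Cb).
Qed.

Lemma hausdorff_isometry (A : set V) (f : V -> V) :
  (forall x y, A x -> A y -> pl_enorm (f x - f y) = pl_enorm (x - y)) ->
  pl_hausdorff (f @` A) = pl_hausdorff A.
Proof.
move=> fiso; apply/eqP; rewrite eq_le; apply/andP; split.
  (* Membership in [A] is part of the relation because [f] is isometric only on [A], while covering
     sets may leave it. *)
  apply: (@hausdorff_le A _ (fun x y => A x /\ f x = y)) => [_ [x Ax <-]|].
    by exists x.
  by move=> x x' _ _ [Ax <-] [Ax' <-]; rewrite fiso.
apply: (@hausdorff_le (f @` A) _ (fun x y => A y /\ f y = x)) => [x Ax|].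
  by exists (f x); first by exists x.
by move=> _ _ y y' [Ay <-] [Ay' <-]; rewrite fiso.
Qed.

End Hausdorff.

Theorem theorem7p1 (R : realType) (n : nat) (psi : 'rV[R]_n -> 'rV[R]_n)
  (s : nat -> seq ('rV[R]_n * R)) :
  pl_contraction psi ->
  (forall k, forall h, h \in s k -> pl_hyperplane_ok h) ->
  (forall x, (@pl_unit_ball R n) x -> pl_polar_comp (s k) x @[k --> \oo] --> psi x) ->
  {in (@pl_unit_ball R n) &, injective psi} ->
  pl_hausdorff (psi @` (@pl_unit_ball R n)) = pl_hausdorff ((@pl_unit_ball R n)).
Proof.
move=> psicon hs spsi psi_inj; apply: hausdorff_isometry.
exact: polar_comp_limit_isometry psicon hs spsi psi_inj.
Qed.
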